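(* Let $M=(M_n)_{n\ge 0}$ be the Thue--Morse sequence. Let $v=(v_n)_{n\ge 0}$ be the sequence in which $v_n$ is the number of $1$'s occurring in $M$ between the $(n+1)$-st and the $(n+2)$-nd occurrence of the letter $0$ (so $v=2,1,0,2,0,1,2,1,0,1,2,\dots$). Let $\vartheta=(\vartheta_n)_{n\ge 0}$ be defined by $\vartheta_n=2$ if $M_n=M_{n+1}$ and $\vartheta_n=M_n$ otherwise, and let $w=(w_n)_{n\ge 0}$ with $w_n\in\{0,1,2\}$ be given by $w_n\equiv \vartheta_n+2 \pmod 3$ (i.e. $w$ is obtained from $\vartheta$ by replacing the letters $0,1,2$ by $2,0,1$ respectively). Then $v=w$.
   Context: The Thue--Morse sequence $M=(M_n)_{n\ge 0}=0110100110010110\cdots$ is the limit of the words $M^{2^n}$ of length $2^n$ defined by: the initial word (length $1$) is $0$, and $M^{2^{n+1}}=M^{2^n}\,\overline{M^{2^n}}$, where $\overline{W}$ is the word obtained from $W$ by switching $0$ and $1$. Equivalently, $M_0=0$, $M_{2n}=M_n$, $M_{2n+1}=1-M_n$. The sequence $\vartheta$ is the one obtained from $M$ by replacing the first digit of each occurrence of $00$ and of $11$ by $2$. Occurrences of the letter $0$ in $M$ are counted from left to right, the first occurrence being $M_0$. *)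

(* Defs.v *)
From mathcomp Require Import all_boot.

Set Implicit Arguments.
Unset Strict Implicit.
Unset Printing Implicit Defensive.

Definition switch (W : seq nat) : seq nat := [seq 1 - a | a <- W].

(* [tm_word k] is the word of length 2 ^ k M^{2^k};
   the letters are the natural numbers 0 and 1. *)
Fixpoint tm_word (k : nat) : seq nat :=
  if k is k'.+1 then tm_word k' ++ switch (tm_word k') else [:: 0].

(* Each word is a prefix of the next one and n < 2 ^ n, so the n-th letter of
   the limit can be read off [tm_word n]; see [thue_morse_limit]. *)
Definition thue_morse (n : nat) : nat := nth 0 (tm_word n) n.

Lemma size_tm_word k : size (tm_word k) = 2 ^ k.
Proof.
by elim: k => //= k IHk; rewrite size_cat size_map IHk expnS mul2n addnn.
Qed.

Lemma nth_tm_word_add j k n :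
  n < 2 ^ k -> nth 0 (tm_word (j + k)) n = nth 0 (tm_word k) n.
Proof.
move=> lt_n; elim: j => //= j IHj.
rewrite nth_cat size_tm_word ifT // (leq_trans lt_n) //.
by rewrite leq_exp2l // leq_addl.
Qed.

Lemma thue_morse_limit k n :
  n < 2 ^ k -> nth 0 (tm_word k) n = thue_morse n.
Proof.
move=> lt_n; rewrite /thue_morse -(nth_tm_word_add n lt_n) addnC.
by rewrite nth_tm_word_add // ltn_expl.
Qed.

Lemma thue_morse_switch k i :
  i < 2 ^ k -> thue_morse (2 ^ k + i) = 1 - thue_morse i.
Proof.
move=> lt_i; rewrite -(@thue_morse_limit k.+1); last first.
  by rewrite expnS mul2n -addnn ltn_add2l.
rewrite /= nth_cat size_tm_word ltnNge leq_addr /= addKn.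
by rewrite (nth_map 0) ?size_tm_word // thue_morse_limit.
Qed.

Lemma exists_zero (p : nat) : exists q, (p <= q) && (thue_morse q == 0).
Proof.
exists (2 ^ p.+1 + 1); rewrite thue_morse_switch; last first.
  by rewrite -(expn0 2) ltn_exp2l.
by rewrite andbT ltnW // ltn_addr // (ltn_trans (ltnSn p)) // ltn_expl.
Qed.

Definition next_zero (p : nat) : nat := ex_minn (exists_zero p).

(* Position of the (n+1)-st occurrence of the letter 0. *)
Fixpoint zero_pos (n : nat) : nat :=
  if n is n'.+1 then next_zero (zero_pos n').+1 else next_zero 0.

Definition v (n : nat) : nat :=
  \sum_((zero_pos n).+1 <= i < zero_pos n.+1 | thue_morse i == 1) 1.

Definition vartheta (n : nat) : nat :=
  if thue_morse n == thue_morse n.+1 then 2 else thue_morse n.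

Definition w (n : nat) : nat := (vartheta n + 2) %% 3.

(* Main.v *)
Require Import Defs.
From mathcomp Require Import all_boot zify.

(** The Thue-Morse sequence [M] is fixed by the substitution 0 -> 01, 1 -> 10:
    [M_(2n) = M_n] and [M_(2n+1) = 1 - M_n].  Hence every aligned block
    [M_(2n) M_(2n+1)] is 01 or 10 and contains exactly one 0, which sits at
    position [2n + M_n].  So the (n+1)-st zero of [M] is at [2n + M_n]
    ([zero_pos_eq]), and between two consecutive zeros there are exactly
    [(2n + 2 + M_(n+1)) - (2n + M_n) - 1 = 1 + M_(n+1) - M_n] ones.  This number
    is 1 if [M_n = M_(n+1)], 2 if [M_n = 0] and [M_(n+1) = 1], and 0 if
    [M_n = 1] and [M_(n+1) = 0], which is [vartheta_n + 2] modulo 3 in all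
    three cases. *)

(** Removing the leading binary digit of a positive integer follows the
    recursion of [tm_word], whose second half repeats the first one switched;
    so this is the induction to use on facts about letters of [M]. *)
Lemma leading_bit_ind (P : nat -> Prop) :
  P 0 -> (forall k i, i < 2 ^ k -> P i -> P (2 ^ k + i)) -> forall n, P n.
Proof.
move=> P0 PS n; have := ltn_expl n (ltnSn 1).
move: {2}n => k; elim: k n => [|k IHk] n; first by case: n.
case: (ltnP n (2 ^ k)) => [/IHk // | le_n lt_n].
have lt_i : n - 2 ^ k < 2 ^ k by rewrite ltn_subLR // addnn -mul2n -expnS.
by rewrite -(subnKC le_n); apply/PS/IHk.
Qed.

Lemma thue_morse_le1 n : thue_morse n <= 1.
Proof.
elim/leading_bit_ind: n => // k i lt_i _.
by rewrite thue_morse_switch // leq_subr.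
Qed.

(** Doubling maps [2 ^ k + i] to [2 ^ k.+1 + 2 * i], so the switch of a block
    and that of its double go together. *)
Lemma thue_morse_double n : thue_morse (2 * n) = thue_morse n.
Proof.
elim/leading_bit_ind: n => // k i lt_i IHi.
rewrite mulnDr -expnS !thue_morse_switch ?IHi //.
by rewrite expnS ltn_mul2l.
Qed.

Lemma thue_morse_doubleS n : thue_morse (2 * n).+1 = 1 - thue_morse n.
Proof.
elim/leading_bit_ind: n => // k i lt_i IHi.
rewrite mulnDr -expnS -addnS !thue_morse_switch ?IHi //.
by rewrite expnS; lia.
Qed.

Lemma next_zero_eq p q :
  p <= q -> thue_morse q = 0 ->
  (forall r, p <= r < q -> thue_morse r <> 0) -> next_zero p = q.
Proof.
move=> le_pq Mq nz; rewrite /next_zero; case: ex_minnP => m /andP[le_pm /eqP Mm].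
move=> /(_ q); rewrite le_pq Mq => /(_ isT) le_mq.
apply/eqP; rewrite eqn_leq le_mq leqNgt /=; apply/negP => lt_mq.
by apply: (nz m); rewrite ?le_pm.
Qed.

Lemma thue_morse_block_zero n : thue_morse (2 * n + thue_morse n) = 0.
Proof.
have := thue_morse_le1 n; case E: (thue_morse n) => [|[|//]] _.
  by rewrite addn0 thue_morse_double.
by rewrite addn1 thue_morse_doubleS E.
Qed.

(** From one zero to the next, the only positions to skip are the second half
    of a block 01 and the first half of a block 10. *)
Lemma zero_pos_eq n : zero_pos n = 2 * n + thue_morse n.
Proof.
elim: n => [|n IHn] /=.
  by apply: next_zero_eq.
have le0 := thue_morse_le1 n; have le1 := thue_morse_le1 n.+1.
rewrite IHn; apply: next_zero_eq; [lia | exact: thue_morse_block_zero |].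
move=> r r_int.
have [[-> M0] | [-> M1]] : (r = (2 * n).+1 /\ thue_morse n = 0) \/
    (r = 2 * n.+1 /\ thue_morse n.+1 = 1) by lia.
  by rewrite thue_morse_doubleS M0.
by rewrite thue_morse_double M1.
Qed.

Theorem lemma2p3 : forall n : nat, v n = w n.
Proof.
move=> n; rewrite /v /w /vartheta !zero_pos_eq.
have M1 := thue_morse_doubleS n; have M2 := thue_morse_double n.+1.
have := thue_morse_le1 n; have := thue_morse_le1 n.+1.
rewrite mulnS !add2n in M2 *.
(* In each of the four cases the interval contains at most the two positions
   [2 * n + 1] and [2 * n + 2]. *)
case E1: (thue_morse n.+1) M2 => [|[|//]] M2 _;
  case E0: (thue_morse n) M1 => [|[|//]] M1 _;
  rewrite ?addn0 ?addn1 /=.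
- by rewrite big_ltn_cond // M1 big_geq.
- by rewrite big_geq.
- by rewrite big_ltn_cond // M1 big_ltn_cond // M2 big_geq.
- by rewrite big_ltn_cond // M2 big_geq.
Qed.
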